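(* Let $M,N\ge 1$ be integers, $W>0$, $\omega>0$, $P_{\mathrm{fix}}>0$, $\chi\ge 0$, $\gamma_{\min}^{\mathrm U},\gamma_{\min}^{\mathrm D}\ge 0$, and for $1\le i\le M$, $1\le j\le N$ let $h_i^{\mathrm U}>0$, $h_j^{\mathrm D}>0$, $h_{ij}\ge 0$ satisfy $h_{ij}(1+\chi)<\min(h_i^{\mathrm U},h_j^{\mathrm D})$ for all $i,j$. For $R_{\mathrm{tot}}\ge 0$ define the optimal energy efficiency $$\beta_{\mathrm{EE}}^{*}(R_{\mathrm{tot}})=\max\ \frac{R_{\mathrm{tot}}}{\omega\sum_{i=1}^{M}\sum_{j=1}^{N}\gamma_{ij}\left(p_{ij}^{\mathrm U}+p_{ij}^{\mathrm D}\right)+P_{\mathrm{fix}}},$$ where the maximum is over all $\gamma_{ij}\ge 0$, $p_{ij}^{\mathrm U}\ge 0$, $p_{ij}^{\mathrm D}\ge 0$ ($1\le i\le M$, $1\le j\le N$) such that $$\sum_{i}\sum_{j}\gamma_{ij}\le 1,\qquad \sum_{i}\sum_{j}\gamma_{ij}\left(R_{ij}^{\mathrm U}+R_{ij}^{\mathrm D}\right)=R_{\mathrm{tot}},$$ $$\sum_{j}\gamma_{ij}\ge\gamma_{\min}^{\mathrm U}\ \ \forall i,\qquad \sum_{i}\gamma_{ij}\ge\gamma_{\min}^{\mathrm D}\ \ \forall j,$$ with $$R_{ij}^{\mathrm U}=W\log_2\left(1+\frac{p_{ij}^{\mathrm U}h_i^{\mathrm U}}{1+\chi}\right),\qquad R_{ij}^{\mathrm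 D}=W\log_2\left(1+\frac{p_{ij}^{\mathrm D}h_j^{\mathrm D}}{1+p_{ij}^{\mathrm U}h_{ij}}\right).$$ Assume that the constraints on $(\gamma_{ij})$ alone are feasible, i.e. $M\gamma_{\min}^{\mathrm U}\le 1$ and $N\gamma_{\min}^{\mathrm D}\le 1$. Then $\beta_{\mathrm{EE}}^{*}$ is a quasi-concave function of the spectral efficiency $\beta_{\mathrm{SE}}=R_{\mathrm{tot}}/W\in[0,\infty)$.
   Context: This describes a time-division network in which a full-duplex base station serves pairs consisting of an uplink user $i$ and a downlink user $j$: $h_i^{\mathrm U}$, $h_j^{\mathrm D}$, $h_{ij}$ are the uplink, downlink and co-channel-interference carrier-to-noise ratios, $\chi$ is the normalized residual self-interference power, $W$ is the bandwidth, $\gamma_{ij}$ is the normalized slot length allocated to pair $(i,j)$, $p_{ij}^{\mathrm U},p_{ij}^{\mathrm D}$ are the uplink and downlink transmit powers of pair $(i,j)$, $\gamma_{\min}^{\mathrm U},\gamma_{\min}^{\mathrm D}$ are the minimum time shares guaranteed to each uplink and downlink user, $\omega$ is the inverse power amplifier efficiency, and $P_{\mathrm{fix}}$ is the fixed circuit power. A function on a convex set is quasi-concave if all its superlevel sets $\{x: f(x)\ge\alpha\}$, $\alpha\in\mathbb{R}$, are convex. *)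

(* Defs.v *)
(* MathComp-Analysis, over an arbitrary [R : realType]. *)
From HB Require Import structures.
From mathcomp Require Export all_boot all_order all_algebra.
From mathcomp Require Export all_classical all_reals all_analysis.

Set Implicit Arguments.
Unset Strict Implicit.
Unset Printing Implicit Defensive.

Import Order.TTheory GRing.Theory Num.Theory.

Local Open Scope classical_set_scope.
Local Open Scope ring_scope.

Definition quasi_concave_on (R : realType) (E : lmodType R)
    (D : set (convex_lmodType E)) (f : E -> R) : Prop :=
  forall alpha : R, convex_set [set x | D x /\ alpha <= f x].

Definition is_maximum (R : realType) (A : set R) (m : R) : Prop :=
  A m /\ ubound A m.

Definition log2 (R : realType) (x : R) : R := ln x / ln 2.

(* [M] uplink and [N] downlink users, indexed from 0. *)
Record network (R : realType) (M N : nat) := Network {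
  bandwidth : R;
  omega : R;             (* inverse power amplifier efficiency *)
  Pfix : R;              (* fixed circuit power *)
  chi : R;               (* normalized residual self-interference power *)
  gminU : R;             (* minimum time share of an uplink user *)
  gminD : R;             (* minimum time share of a downlink user *)
  hU : 'I_M -> R;        (* uplink carrier-to-noise ratios *)
  hD : 'I_N -> R;        (* downlink carrier-to-noise ratios *)
  hI : 'M[R]_(M, N)      (* co-channel-interference carrier-to-noise ratios *)
}.

Section EnergyEfficiency.
Variables (R : realType) (M N : nat) (net : network R M N).
Implicit Types gamma pU pD : 'M[R]_(M, N).

Definition rateU pU (i : 'I_M) (j : 'I_N) : R :=
  bandwidth net * log2 (1 + pU i j * hU net i / (1 + chi net)).

Definition rateD pU pD (i : 'I_M) (j : 'I_N) : R :=
  bandwidth net * log2 (1 + pD i j * hD net j / (1 + pU i j * hI net i j)).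

Definition sum_rate gamma pU pD : R :=
  \sum_(i < M) \sum_(j < N) gamma i j * (rateU pU i j + rateD pU pD i j).

Definition total_power gamma pU pD : R :=
  omega net * (\sum_(i < M) \sum_(j < N) gamma i j * (pU i j + pD i j))
  + Pfix net.

Definition feasible (Rtot : R) gamma pU pD : Prop :=
  [/\ forall i j, [/\ 0 <= gamma i j, 0 <= pU i j & 0 <= pD i j],
      \sum_(i < M) \sum_(j < N) gamma i j <= 1,
      sum_rate gamma pU pD = Rtot,
      forall i, gminU net <= \sum_(j < N) gamma i j
    & forall j, gminD net <= \sum_(i < M) gamma i j].

Definition EE_values (Rtot : R) : set R :=
  [set ee | exists gamma pU pD,
     feasible Rtot gamma pU pD /\ ee = Rtot / total_power gamma pU pD].

(* [sup] is a total function; it is the required maximum of [EE_values Rtot]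
   exactly when [is_maximum (EE_values Rtot) (betaEE Rtot)] holds. *)
Definition betaEE (Rtot : R) : R := sup (EE_values Rtot).

(* Optimal energy efficiency as a function of the spectral efficiency
   [Rtot / bandwidth]. *)
Definition betaEE_of_SE (betaSE : R) : R := betaEE (bandwidth net * betaSE).

End EnergyEfficiency.

(* Main.v *)
(* For one pair of users, write u and v for the uplink and downlink rates in nats
   and set a = hU / (1 + chi), d = hD, h = hI.  The power needed is
     (e^u - 1)/a + (e^v - 1)(1 + h (e^u - 1)/a)/d
       = wU (e^u - 1) + wD (e^v - 1) + wI (e^(u+v) - 1),
   with wI = h/(ad), wU = 1/a - wI and wD = 1/d - wI.  The assumption on h makes
   these weights nonnegative, so the power is jointly convex in (u, v), and the
   energy g (pU + pD) of a slot is the perspective of a convex function of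
   (g u, g v), i.e. the supremum of its tangent cuts, which are linear in
   (g, g u, g v).  In these variables, with one epigraph variable per pair, the
   problem becomes a linear one over a closed convex set.  Compactness gives the
   maximum; convexity of the lifted set in R_tot and the fact that
   alpha <= beta(R_tot) iff alpha (omega P + Pfix) <= R_tot for some lifted
   point give quasi-concavity. *)
Require Import Defs.
From mathcomp Require Import all_boot all_order all_algebra.
From mathcomp Require Import all_classical all_reals all_analysis.
From mathcomp Require Import ring lra.

Set Implicit Arguments.
Unset Strict Implicit.
Unset Printing Implicit Defensive.

Import Order.TTheory GRing.Theory Num.Theory.
Import numFieldNormedType.Exports.

Local Open Scope classical_set_scope.
Local Open Scope ring_scope.

Lemma sum2_conv (R : realType) (M N : nat) (s t : R) (f g : 'I_M -> 'I_N -> R) :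
  \sum_(i < M) \sum_(j < N) (s * f i j + t * g i j) =
  s * (\sum_(i < M) \sum_(j < N) f i j) + t * (\sum_(i < M) \sum_(j < N) g i j).
Proof.
rewrite !mulr_sumr -big_split; apply: eq_bigr => i _ /=.
by rewrite !mulr_sumr -big_split.
Qed.

Lemma le_sum2 (R : realType) (M N : nat) (f : 'I_M -> 'I_N -> R) :
  (forall i j, 0 <= f i j) ->
  forall i j, f i j <= \sum_(i < M) \sum_(j < N) f i j.
Proof.
move=> f_ge0 i j; rewrite (bigD1 i) //= (bigD1 j) //= -addrA lerDl.
by rewrite addr_ge0 ?sumr_ge0 // => k _; rewrite sumr_ge0.
Qed.

(** * Power of one pair of users and its tangent cuts *)

Section PairPower.
Variable R : realType.
Implicit Types a d h u v y z g p : R.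

(** For [g > 0] this is [g] times the tangent line of [e^u - 1] at [y], evaluated at [u = x / g].
    Written without the quotient, it stays linear in [(g, x)] and makes sense at [g = 0]. *)
Definition tangent y g x := expR y * (x + g - y * g) - g.

Lemma tangent_le y g u : 0 <= g -> tangent y g (g * u) <= g * (expR u - 1).
Proof.
move=> g0; rewrite /tangent [leRHS]mulrBr mulr1 lerB //.
have -> : g * u + g - y * g = g * (1 + (u - y)) by ring.
rewrite mulrCA ler_wpM2l //.
have -> : expR u = expR y * expR (u - y) by rewrite -expRD addrC subrK.
by rewrite ler_wpM2l ?expR_ge0 // expR_ge1Dx.
Qed.

Lemma tangent_eq u g : tangent u g (g * u) = g * (expR u - 1).
Proof. rewrite /tangent; ring. Qed.

Definition wI a d h := h / (a * d).
Definition wU a d h := a^-1 - wI a d h.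
Definition wD a d h := d^-1 - wI a d h.

(** [powU] and [powD] invert the rate formulas: the downlink power must also overcome the
    interference [powU a u * h] caused by the uplink. *)
Definition powU a u := (expR u - 1) / a.
Definition powD a d h u v := (expR v - 1) * (1 + powU a u * h) / d.

Lemma powUDE a d h u v : a != 0 -> d != 0 ->
  powU a u + powD a d h u v =
  wU a d h * (expR u - 1) + wD a d h * (expR v - 1)
    + wI a d h * (expR (u + v) - 1).
Proof.
by move=> a0 d0; rewrite /powD /powU /wU /wD /wI expRD; field; rewrite a0 d0.
Qed.

Lemma powU_ge0 a u : 0 < a -> 0 <= u -> 0 <= powU a u.
Proof.
move=> a0 u0; rewrite mulr_ge0 ?invr_ge0 ?(ltW a0) // subr_ge0.
by rewrite -expR0 ler_expR.
Qed.

Lemma powD_ge0 a d h u v : 0 < a -> 0 < d -> 0 <= h -> 0 <= u -> 0 <= v ->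
  0 <= powD a d h u v.
Proof.
move=> a0 d0 h0 u0 v0.
rewrite /powD mulrAC; apply: mulr_ge0; first exact: powU_ge0.
by rewrite addr_ge0 // mulr_ge0 // powU_ge0.
Qed.

Lemma ln_powU a u : a != 0 -> ln (1 + powU a u * a) = u.
Proof. by move=> a0; rewrite divfK // addrC subrK expRK. Qed.

Lemma ln_powD a d h u v : 0 < a -> 0 < d -> 0 <= h -> 0 <= u ->
  ln (1 + powD a d h u v * d / (1 + powU a u * h)) = v.
Proof.
move=> a0 d0 h0 u0; rewrite /powD divfK ?gt_eqF // mulfK; first by rewrite addrC subrK expRK.
by rewrite gt_eqF // ltr_pwDl // mulr_ge0 // powU_ge0.
Qed.

Lemma powU_ln a p : 0 < a -> 0 <= p -> powU a (ln (1 + p * a)) = p.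
Proof.
move=> a0 p0; rewrite /powU lnK; first by rewrite [1 + _]addrC addrK mulfK ?gt_eqF.
by rewrite posrE ltr_pwDl // mulr_ge0 // ltW.
Qed.

Lemma powD_ln a d h p q : 0 < a -> 0 < d -> 0 <= h -> 0 <= p -> 0 <= q ->
  powD a d h (ln (1 + p * a)) (ln (1 + q * d / (1 + p * h))) = q.
Proof.
move=> a0 d0 h0 p0 q0; have ph : 0 < 1 + p * h by rewrite ltr_pwDl // mulr_ge0.
rewrite /powD powU_ln // lnK; last first.
  by rewrite posrE ltr_pwDl // divr_ge0 ?(ltW ph) // mulr_ge0 // ltW.
by rewrite [1 + q * _ / _]addrC addrK divfK ?gt_eqF // mulfK ?gt_eqF.
Qed.

Lemma wI_ge0 a d h : 0 < a -> 0 < d -> 0 <= h -> 0 <= wI a d h.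
Proof. by move=> a0 d0 h0; rewrite divr_ge0 // mulr_ge0 // ltW. Qed.

(** Factor [wU = (1 - h / d) / a]. Strict positivity of [wU] and [wD] is what lets [power_cut0]
    force both rates to vanish. *)
Lemma wU_gt0 a d h : 0 < a -> 0 < d -> h < d -> 0 < wU a d h.
Proof.
move=> a0 d0 hd; rewrite /wU /wI invfM mulrCA -{1}[a^-1]mulr1 -mulrBr.
by rewrite mulr_gt0 ?invr_gt0 // subr_gt0 ltr_pdivrMr ?mul1r.
Qed.

Lemma wD_gt0 a d h : 0 < a -> 0 < d -> h < a -> 0 < wD a d h.
Proof.
by move=> a0 d0 ha; rewrite /wD /wI [a * d]mulrC; exact: wU_gt0.
Qed.

(** The interference term is cut at [y + z], so that for [y], [z] equal to the actual rates all
    three tangents touch at once and the cut is exact. *)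
Definition power_cut a d h y z g u v :=
  wU a d h * tangent y g u + wD a d h * tangent z g v
  + wI a d h * tangent (y + z) g (u + v).

Lemma power_cut_conv a d h y z s t g1 u1 v1 g2 u2 v2 :
  power_cut a d h y z (s * g1 + t * g2) (s * u1 + t * u2) (s * v1 + t * v2) =
  s * power_cut a d h y z g1 u1 v1 + t * power_cut a d h y z g2 u2 v2.
Proof. rewrite /power_cut /tangent; ring. Qed.

Lemma power_cut_le a d h y z g u v :
  0 < a -> 0 < d -> 0 <= h -> h < a -> h < d -> 0 <= g ->
  power_cut a d h y z g (g * u) (g * v) <= g * (powU a u + powD a d h u v).
Proof.
move=> a0 d0 h0 ha hd g0; rewrite powUDE ?gt_eqF // /power_cut -mulrDr.
rewrite [leRHS]mulrDr [in leRHS]mulrDr ![g * (_ * _)]mulrCA.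
have wU0 := wU_gt0 a0 d0 hd; have wD0 := wD_gt0 a0 d0 ha.
have wI0 := wI_ge0 a0 d0 h0.
by rewrite !lerD // ler_wpM2l ?tangent_le // ltW.
Qed.

Lemma power_cut_eq a d h g u v : 0 < a -> 0 < d ->
  power_cut a d h u v g (g * u) (g * v) = g * (powU a u + powD a d h u v).
Proof.
move=> a0 d0; rewrite powUDE ?gt_eqF // /power_cut -mulrDr !tangent_eq; ring.
Qed.

(* A slot of zero length carries no rate, since letting [y], [z] grow in the
   cuts would require infinite power. *)
Lemma power_cut0 a d h u v p :
  0 < a -> 0 < d -> 0 <= h -> h < a -> h < d -> 0 <= u -> 0 <= v ->
  (forall y z, power_cut a d h y z 0 u v <= p) -> u = 0 /\ v = 0.
Proof.
move=> a0 d0 h0 ha hd u0 v0 cutp.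
have wU0 := wU_gt0 a0 d0 hd; have wD0 := wD_gt0 a0 d0 ha.
have wI0 := wI_ge0 a0 d0 h0.
(* At [g = 0] each tangent reduces to [e^y] times its rate; the nonnegative interference term is
   dropped. *)
have cutE y z : wU a d h * (expR y * u) + wD a d h * (expR z * v) <= p.
  apply: le_trans (cutp y z); rewrite /power_cut /tangent !(mulr0, subr0, addr0) lerDl.
  by rewrite mulr_ge0 // mulr_ge0 ?addr_ge0 ?expR_ge0.
have grow w x : 0 < w -> 0 <= x -> (forall y, w * (expR y * x) <= p) -> x = 0.
  move=> w0 x0 wp; apply/eqP; rewrite eq_le x0 andbT leNgt; apply/negP => xgt0.
  have wx0 : 0 < w * x by rewrite mulr_gt0.
  (* With [y = p / (w x)], the bound [e^y >= 1 + y] gives [w x e^y >= w x + p > p]. *)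
  have := wp (p / (w * x)); rewrite mulrCA mulrC leNgt => /negP; apply.
  rewrite -ltr_pdivrMl // mulrC.
  by apply: lt_le_trans (expR_ge1Dx _); rewrite ltrDr.
split; [apply: grow wU0 u0 _ => y|apply: grow wD0 v0 _ => z].
  by apply: le_trans (cutE y 0); rewrite lerDl !mulr_ge0 ?expR_ge0 // ltW.
by apply: le_trans (cutE 0 z); rewrite lerDr !mulr_ge0 ?expR_ge0 // ltW.
Qed.

End PairPower.

(** * Closed sets defined by continuous functions *)

Section ClosedSets.
Variables (R : realType) (T : topologicalType).
Implicit Types f g : T -> R.

Lemma closed_forall (I : Type) (P : I -> T -> Prop) :
  (forall i, closed [set x | P i x]) -> closed [set x | forall i, P i x].
Proof.
move=> cP; have -> : [set x | forall i, P i x] = \bigcap_i [set x | P i x].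
  by apply/seteqP; split => [x Px i _|x Px i]; apply: Px.
by apply: closed_bigI => i _; exact: cP.
Qed.

Lemma closed_le_fun f g :
  continuous f -> continuous g -> closed [set x | f x <= g x].
Proof.
move=> cf cg.
have -> : [set x | f x <= g x] = (fun x => g x - f x) @^-1` [set r | 0 <= r].
  by apply/seteqP; split => x /=; rewrite subr_ge0.
apply: preimage_closed; last exact: closed_ge.
by move=> x _; apply: continuousB; [exact: cg|exact: cf].
Qed.

Lemma closed_eq_fun f g :
  continuous f -> continuous g -> closed [set x | f x = g x].
Proof.
move=> cf cg.
have -> : [set x | f x = g x] = [set x | f x <= g x] `&` [set x | g x <= f x].
  apply/seteqP; split => x /= => [->//|[fg gf]].
  by apply/eqP; rewrite eq_le fg gf.
by apply: closedI; exact: closed_le_fun.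
Qed.

Lemma continuous_sum (n : nat) (F : 'I_n -> T -> R) :
  (forall i, continuous (F i)) -> continuous (fun x => \sum_(i < n) F i x).
Proof.
move=> cF; apply: continuous_big => [|i _]; last exact: cF.
exact: add_continuous.
Qed.

Lemma continuous_add f g :
  continuous f -> continuous g -> continuous (fun x => f x + g x).
Proof. by move=> cf cg x; apply: continuousD; [exact: cf|exact: cg]. Qed.

Lemma continuous_sub f g :
  continuous f -> continuous g -> continuous (fun x => f x - g x).
Proof. by move=> cf cg x; apply: continuousB; [exact: cf|exact: cg]. Qed.

Lemma continuous_scale r f : continuous f -> continuous (fun x => r * f x).
Proof.
by move=> cf x; apply: continuousM; [exact: cst_continuous|exact: cf].
Qed.

End ClosedSets.

(** * The lifted problem and its convexity *)

Section Lifting.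
Variables (R : realType) (M N : nat) (net : network R M N).
Implicit Types gamma pU pD : 'M[R]_(M, N).
Implicit Types g U V P : 'I_M -> 'I_N -> R.

Let a i := hU net i / (1 + chi net).
Let d j := hD net j.
Let h i j := hI net i j.
(** Conversion from nats: [W log2 x = kappa ln x]. *)
Let kappa := bandwidth net / ln 2.

(* [U] and [V] stand for the products [gamma * rate] (in nats), and [P] bounds the
   energy [gamma * (pU + pD)] from above. *)
Definition lift (Rtot : R) g U V P : Prop :=
  [/\ forall i j, [/\ 0 <= g i j, 0 <= U i j, 0 <= V i j & 0 <= P i j],
      forall i j y z,
        power_cut (a i) (d j) (h i j) y z (g i j) (U i j) (V i j) <= P i j,
      \sum_(i < M) \sum_(j < N) g i j <= 1,
      kappa * (\sum_(i < M) \sum_(j < N) (U i j + V i j)) = Rtot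
    & (forall i, gminU net <= \sum_(j < N) g i j) /\
      (forall j, gminD net <= \sum_(i < M) g i j)].

(** Every constraint, including each cut at fixed [y], [z], is linear in [(Rtot, g, U, V, P)]
    jointly, so [Rtot] may vary along the segment. *)
Lemma lift_conv s t R1 g1 U1 V1 P1 R2 g2 U2 V2 P2 :
  0 <= s -> 0 <= t -> s + t = 1 ->
  lift R1 g1 U1 V1 P1 -> lift R2 g2 U2 V2 P2 ->
  lift (s * R1 + t * R2)
    (fun i j => s * g1 i j + t * g2 i j) (fun i j => s * U1 i j + t * U2 i j)
    (fun i j => s * V1 i j + t * V2 i j) (fun i j => s * P1 i j + t * P2 i j).
Proof.
move=> s0 t0 st [nn1 cut1 le1 eq1 [mU1 mD1]] [nn2 cut2 le2 eq2 [mU2 mD2]].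
have conv_ge c x y : c <= x -> c <= y -> c <= s * x + t * y.
  move=> cx cy; rewrite -[c]mul1r -st mulrDl.
  by rewrite lerD // ler_wpM2l.
split.
- move=> i j; have [? ? ? ?] := nn1 i j; have [? ? ? ?] := nn2 i j.
  by split; exact: conv_ge.
- by move=> i j y z; rewrite power_cut_conv lerD // ler_wpM2l.
- rewrite sum2_conv -[1]st -[in leRHS](mulr1 s) -[in leRHS](mulr1 t).
  by rewrite lerD // ler_wpM2l.
- under eq_bigr do under eq_bigr do rewrite addrACA -!mulrDr.
  by rewrite sum2_conv mulrDr !(mulrCA kappa) eq1 eq2.
- split=> k; rewrite big_split -!mulr_sumr; exact: conv_ge.
Qed.

(** * Passing between feasible and lifted points *)

Hypotheses (W_gt0 : 0 < bandwidth net) (omega_gt0 : 0 < omega net).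
Hypotheses (Pfix_gt0 : 0 < Pfix net) (chi_ge0 : 0 <= chi net).
Hypotheses (hU_gt0 : forall i, 0 < hU net i) (hD_gt0 : forall j, 0 < hD net j).
Hypotheses (hI_ge0 : forall i j, 0 <= hI net i j).
Hypothesis hI_small : forall i j,
  hI net i j * (1 + chi net) < Num.min (hU net i) (hD net j).

Let a_gt0 i : 0 < a i.
Proof. by rewrite divr_gt0 // ltr_pwDl. Qed.

Let h_lt_a i j : h i j < a i.
Proof.
by rewrite ltr_pdivlMr ?ltr_pwDl //; move: (hI_small i j); rewrite lt_min => /andP[].
Qed.

Let h_lt_d i j : h i j < d j.
Proof.
move: (hI_small i j); rewrite lt_min => /andP[_]; apply: le_lt_trans.
by rewrite ler_peMr // lerDl.
Qed.

Let kappa_gt0 : 0 < kappa.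
Proof. by rewrite divr_gt0 // ln_gt0 // ltr1n. Qed.

Let rateE pU pD i j : rateU net pU i j + rateD net pU pD i j =
  kappa * (ln (1 + pU i j * a i) + ln (1 + pD i j * d j / (1 + pU i j * h i j))).
Proof.
by rewrite /rateU /rateD /log2 /a /d /h /kappa [pU i j * (_ / _)]mulrA; ring.
Qed.

Lemma feasible_lift Rtot gamma pU pD : feasible net Rtot gamma pU pD ->
  exists U V, lift Rtot gamma U V (fun i j => gamma i j * (pU i j + pD i j)).
Proof.
move=> [nn le1 eqR mU mD].
pose u i j := ln (1 + pU i j * a i).
pose v i j := ln (1 + pD i j * d j / (1 + pU i j * h i j)).
exists (fun i j => gamma i j * u i j), (fun i j => gamma i j * v i j).
split => //.
- move=> i j; have [g0 pU0 pD0] := nn i j.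
  have u0 : 0 <= u i j by rewrite ln_ge0 // lerDl mulr_ge0 // ltW.
  have v0 : 0 <= v i j.
    rewrite ln_ge0 // lerDl divr_ge0 //; first by rewrite mulr_ge0 // ltW.
    by rewrite addr_ge0 // mulr_ge0 ?hI_ge0.
  by split; rewrite ?mulr_ge0 ?addr_ge0.
- move=> i j y z; have [g0 u0 v0] := nn i j.
  apply: le_trans (power_cut_le _ _ _ _ _ _ _ _ _ _) _ => //.
  by rewrite powU_ln // powD_ln.
- rewrite -eqR /sum_rate mulr_sumr; apply: eq_bigr => i _.
  rewrite mulr_sumr; apply: eq_bigr => j _.
  by rewrite rateE -mulrDr mulrCA.
Qed.

(** Dividing by the slot length recovers the rates, and the rates determine the powers. The cut at
    those rates is exact, so the true energy is at most [P]. *)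
Lemma lift_feasible Rtot g U V P : lift Rtot g U V P ->
  exists gamma pU pD, feasible net Rtot gamma pU pD /\
    \sum_(i < M) \sum_(j < N) gamma i j * (pU i j + pD i j) <=
    \sum_(i < M) \sum_(j < N) P i j.
Proof.
move=> [nn cutP le1 eqR [mU mD]].
pose u i j := U i j / g i j; pose v i j := V i j / g i j.
(* Where [g i j = 0] the quotients are 0 by convention, and the products are still right because
   [power_cut0] gives [U i j = V i j = 0]. *)
have gu i j : g i j * u i j = U i j /\ g i j * v i j = V i j.
  have [g0 U0 V0 P0] := nn i j; rewrite /u /v.
  have [gij0|gij0] := eqVneq (g i j) 0; last by rewrite !(mulrC (g i j)) !divfK.
  have [|-> ->] := power_cut0 (a_gt0 i) (hD_gt0 j) (hI_ge0 i j) (h_lt_a i j)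
    (h_lt_d i j) U0 V0 (p := P i j).
    by rewrite -gij0; exact: cutP.
  by rewrite gij0 !mul0r.
have u0 i j : 0 <= u i j by have [? ? ? ?] := nn i j; rewrite divr_ge0.
have v0 i j : 0 <= v i j by have [? ? ? ?] := nn i j; rewrite divr_ge0.
exists (\matrix_(i, j) g i j), (\matrix_(i, j) powU (a i) (u i j)),
  (\matrix_(i, j) powD (a i) (d j) (h i j) (u i j) (v i j)).
split.
  split.
  - move=> i j; rewrite !mxE; have [? ? ? ?] := nn i j.
    by split => //; [exact: powU_ge0|apply: powD_ge0].
  - by under eq_bigr do under eq_bigr do rewrite mxE.
  - rewrite -eqR /sum_rate mulr_sumr; apply: eq_bigr => i _.
    rewrite mulr_sumr; apply: eq_bigr => j _.
    rewrite rateE !mxE ln_powU ?gt_eqF // ln_powD //.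
    by rewrite mulrCA mulrDr; have [-> ->] := gu i j.
  - by move=> i; under eq_bigr do rewrite mxE.
  - by move=> j; under eq_bigr do rewrite mxE.
apply: ler_sum => i _; apply: ler_sum => j _; rewrite !mxE -power_cut_eq //.
by have [-> ->] := gu i j; exact: cutP.
Qed.

(** Give every pair the time share [1 / (M N)], no downlink power, and the uplink power for which
    its rate is exactly [Rtot]. The shares of each user then add up to [1 / M] or [1 / N]. *)
Lemma feasible_exists Rtot : (1 <= M)%N -> (1 <= N)%N ->
  M%:R * gminU net <= 1 -> N%:R * gminD net <= 1 -> 0 <= Rtot ->
  exists gamma pU pD, feasible net Rtot gamma pU pD.
Proof.
move=> M1 N1 mU mD R0.
have M0 : 0 < M%:R :> R by rewrite ltr0n.
have N0 : 0 < N%:R :> R by rewrite ltr0n.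
exists (const_mx (M%:R^-1 / N%:R)),
  (\matrix_(i, j) powU (a i) (Rtot / kappa)), (const_mx 0).
have sumN : \sum_(j < N) (M%:R^-1 / N%:R) = M%:R^-1 :> R.
  by rewrite sumr_const card_ord -[_ *+ _]mulr_natr divfK ?gt_eqF.
have sumM : \sum_(i < M) (M%:R^-1 / N%:R) = N%:R^-1 :> R.
  by rewrite sumr_const card_ord -[_ *+ _]mulr_natr mulrAC mulVf ?mul1r ?gt_eqF.
have sumMN : \sum_(i < M) M%:R^-1 = 1 :> R.
  by rewrite sumr_const card_ord -[_ *+ _]mulr_natr mulVf ?gt_eqF.
split.
- move=> i j; rewrite !mxE; split => //.
  by rewrite powU_ge0 // divr_ge0 // ltW.
- by under eq_bigr do (under eq_bigr do rewrite mxE; rewrite sumN); rewrite sumMN.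
- rewrite /sum_rate.
  under eq_bigr => i _.
    under eq_bigr => j _.
      rewrite rateE !mxE ln_powU ?gt_eqF // !mul0r addr0 ln1 addr0.
      rewrite [kappa * _]mulrC divfK ?gt_eqF //.
      over.
    rewrite -mulr_suml sumN.
    over.
  by rewrite -mulr_suml sumMN mul1r.
- move=> i; under eq_bigr do rewrite mxE.
  by rewrite sumN -[leRHS]mulr1 mulrC ler_pdivlMr // mulrC.
- move=> j; under eq_bigr do rewrite mxE.
  by rewrite sumM -[leRHS]mulr1 mulrC ler_pdivlMr // mulrC.
Qed.

(** A continuous function attains its minimum on a nonempty compact set. Confining the coordinates
    to [[0, B]] loses only points whose total energy exceeds that of the given one. *)
Lemma lift_min Rtot g0 U0 V0 P0 : lift Rtot g0 U0 V0 P0 ->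
  exists g U V P, lift Rtot g U V P /\
    forall g' U' V' P', lift Rtot g' U' V' P' ->
      \sum_(i < M) \sum_(j < N) P i j <= \sum_(i < M) \sum_(j < N) P' i j.
Proof.
move=> lift0.
(* The four families are packed into one function, the two booleans naming the family, so that
   Tychonoff applies to a single product of segments. *)
pose X := {ptws ('I_M * 'I_N) * (bool * bool) -> R}.
pose gX (x : X) i j := x (i, j, (true, true)).
pose UX (x : X) i j := x (i, j, (true, false)).
pose VX (x : X) i j := x (i, j, (false, true)).
pose PX (x : X) i j := x (i, j, (false, false)).
pose total P := \sum_(i < M) \sum_(j < N) P i j.
pose point g U V P : X := fun c => let: (i, j, (b1, b2)) := c in
  if b1 then if b2 then g i j else U i j else if b2 then V i j else P i j.
(* The summands bound [g] by 1, [U] and [V] by [Rtot / kappa], and [P] by [total P0]. *)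
pose B := 1 + Rtot / kappa + total P0.
pose liftX (x : X) := lift Rtot (gX x) (UX x) (VX x) (PX x).
pose A : set X := [set x | forall c, `[0, B]%classic (x c)] `&` [set x | liftX x].
have Rtot0 g U V P : lift Rtot g U V P -> 0 <= Rtot.
  move=> [nn _ _ <- _]; rewrite mulr_ge0 ?(ltW kappa_gt0) // sumr_ge0 // => i _.
  by rewrite sumr_ge0 // => j _; have [? ? ? ?] := nn i j; rewrite addr_ge0.
have total_ge0 g U V P : lift Rtot g U V P -> 0 <= total P.
  move=> [nn _ _ _ _]; rewrite sumr_ge0 // => i _.
  by rewrite sumr_ge0 // => j _; have [] := nn i j.
have lift_A g U V P : lift Rtot g U V P -> total P <= total P0 ->
    A (point g U V P).
  move=> lft PP0; split => //= -[[i j] b] /=.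
  have := Rtot0 _ _ _ _ lft; have := total_ge0 _ _ _ _ lift0.
  case: lft => nn _ le1 eqR _ tot0 R0.
  have Rk0 : 0 <= Rtot / kappa by rewrite divr_ge0 // ltW.
  have g1 : g i j <= 1.
    by apply: le_trans le1; apply: le_sum2 => k l; have [] := nn k l.
  have UV1 : U i j + V i j <= Rtot / kappa.
    rewrite ler_pdivlMr // mulrC -eqR ler_pM2l //.
    apply: (le_sum2 (f := fun k l => U k l + V k l)) => k l.
    by have [? ? ? ?] := nn k l; rewrite addr_ge0.
  have P1 : P i j <= total P0.
    by apply: le_trans PP0; apply: le_sum2 => k l; have [] := nn k l.
  have [? ? ? ?] := nn i j.
  by rewrite in_itv /= /B; case: b => [[] []]; lra.
have cX (c : ('I_M * 'I_N) * (bool * bool)) : continuous (fun x : X => x c).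
  exact: (@proj_continuous _ (fun=> R)).
have cst (r : R) : continuous (fun _ : X => r) by exact: cst_continuous.
have cA : compact A.
  apply: compact_closedI.
    by apply: (@tychonoff _ (fun=> R) (fun=> `[0, B]%classic)) => c; exact: segment_compact.
  (* The lifted constraints are split into closed sets; the cuts form an intersection over all [y],
     [z] of closed half-spaces. *)
  have -> : [set x | liftX x] =
      [set x | forall i j, 0 <= gX x i j] `&` [set x | forall i j, 0 <= UX x i j]
      `&` [set x | forall i j, 0 <= VX x i j] `&` [set x | forall i j, 0 <= PX x i j]
      `&` [set x | forall i j y z,
            power_cut (a i) (d j) (h i j) y z (gX x i j) (UX x i j) (VX x i j) <= PX x i j]
      `&` [set x | total (gX x) <= 1]
      `&` [set x | kappa * total (fun i j => UX x i j + VX x i j) = Rtot]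
      `&` [set x | forall i, gminU net <= \sum_(j < N) gX x i j]
      `&` [set x | forall j, gminD net <= \sum_(i < M) gX x i j].
    apply/seteqP; split => x /=.
      by move=> [nn ? ? ? [? ?]]; (do 8?split) => // i j; have [] := nn i j.
    by move=> [[[[[[[[]]]]]]]] *; do !split.
  apply: closedI; last first.
    apply: closed_forall => j; apply: closed_le_fun => //.
    by apply: continuous_sum => ?; exact: cX.
  apply: closedI; last first.
    apply: closed_forall => i; apply: closed_le_fun => //.
    by apply: continuous_sum => ?; exact: cX.
  apply: closedI; last first.
    apply: closed_eq_fun => //; apply: continuous_scale.
    by do 2![apply: continuous_sum => ?]; apply: continuous_add; exact: cX.
  apply: closedI; last first.
    by apply: closed_le_fun => //; do 2![apply: continuous_sum => ?]; exact: cX.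
  apply: closedI; last first.
    do 4![apply: closed_forall => ?]; apply: closed_le_fun; last exact: cX.
    have ct w y (u v : X -> R) : continuous u -> continuous v ->
        continuous (fun x => w * tangent y (u x) (v x)).
      move=> cu cv; rewrite /tangent; apply: continuous_scale.
      apply: continuous_sub => //; apply: continuous_scale.
      by apply: continuous_sub; [apply: continuous_add|apply: continuous_scale].
    by apply: continuous_add; [apply: continuous_add|]; apply: ct;
      (exact: cX || by apply: continuous_add; exact: cX).
  have cnonneg (c : 'I_M -> 'I_N -> ('I_M * 'I_N) * (bool * bool)) :
      closed [set x : X | forall i j, 0 <= x (c i j)].
    by do 2![apply: closed_forall => ?]; apply: closed_le_fun.
  by do 3![apply: closedI; last exact: cnonneg]; exact: cnonneg.
have ctotal : {within A, continuous (fun x : X => total (PX x))}.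
  apply: continuous_subspaceT.
  by do 2![apply: continuous_sum => ?]; exact: cX.
have A0 : A !=set0 by exists (point g0 U0 V0 P0); exact: lift_A.
have [x /set_mem [_ lx] xmin] := compact_EVT_min A0 cA ctotal.
exists (gX x), (UX x), (VX x), (PX x); split => // g U V P lft.
(* A competitor no costlier than the initial point lies in [A]; a costlier one is beaten through the
   initial point. *)
have [PP0|/ltW PP0] := leP (total P) (total P0).
  by apply: (xmin (point g U V P)); apply/mem_set/lift_A.
by apply: le_trans PP0; apply: (xmin (point g0 U0 V0 P0)); apply/mem_set/lift_A.
Qed.

(** * Attainment of the maximum and quasi-concavity *)

Lemma total_power_gt0 Rtot gamma pU pD :
  feasible net Rtot gamma pU pD -> 0 < total_power net gamma pU pD.
Proof.
move=> [nn _ _ _ _]; rewrite ltr_wpDl // mulr_ge0 ?(ltW omega_gt0) //.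
rewrite sumr_ge0 // => i _; rewrite sumr_ge0 // => j _.
by have [? ? ?] := nn i j; rewrite mulr_ge0 ?addr_ge0.
Qed.

Hypotheses (M_ge1 : (1 <= M)%N) (N_ge1 : (1 <= N)%N).
Hypothesis gminU_feasible : M%:R * gminU net <= 1.
Hypothesis gminD_feasible : N%:R * gminD net <= 1.

(** At fixed [Rtot] the ratio decreases with the energy. The lifted minimiser yields a feasible
    point with no more energy, while every feasible competitor lifts with its exact energy. *)
Lemma betaEE_is_maximum Rtot : 0 <= Rtot ->
  is_maximum (EE_values net Rtot) (betaEE net Rtot).
Proof.
(* A maximum, once it exists, coincides with [sup]. *)
move=> R0; suff [m [vm um]] : exists m, is_maximum (EE_values net Rtot) m.
  rewrite /betaEE (_ : sup _ = m) //; apply/eqP; rewrite eq_le.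
  by rewrite ge_sup //=; [apply: ub_le_sup => //; exists m|exists m].
have [g0 [pU0 [pD0 /feasible_lift[U0 [V0 /lift_min]]]]] :=
  feasible_exists M_ge1 N_ge1 gminU_feasible gminD_feasible R0.
move=> [g [U [V [P [/lift_feasible[gamma [pU [pD [fs powP]]]] minP]]]]].
exists (Rtot / total_power net gamma pU pD); split; first by exists gamma, pU, pD.
move=> _ [gamma' [pU' [pD' [fs' ->]]]].
have [U' [V' /minP leP]] := feasible_lift fs'.
rewrite ler_wpM2l // lef_pV2 ?posrE ?(total_power_gt0 fs) ?(total_power_gt0 fs') //.
by rewrite /total_power lerD2r ler_pM2l // (le_trans powP).
Qed.

(** This turns a superlevel set into an existence statement whose witnesses can be combined
    convexly. *)
Lemma le_betaEE alpha Rtot : 0 <= Rtot ->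
  alpha <= betaEE net Rtot <->
  exists g U V P, lift Rtot g U V P /\
    alpha * (omega net * (\sum_(i < M) \sum_(j < N) P i j) + Pfix net) <= Rtot.
Proof.
move=> R0; have [[gamma [pU [pD [fs betaE]]]] ub] := betaEE_is_maximum R0; split.
  have [U [V lft]] := feasible_lift fs.
  rewrite betaE ler_pdivlMr ?(total_power_gt0 fs) // => alphaR.
  by do 4!eexists; split; [exact: lft|exact: alphaR].
move=> [g [U [V [P [/lift_feasible[gamma' [pU' [pD' [fs' powP]]]] alphaR]]]]].
have tp0 := total_power_gt0 fs'.
apply: (@le_trans _ _ (Rtot / total_power net gamma' pU' pD')); last first.
  by apply: ub; exists gamma', pU', pD'.
(* Replacing [P] by the smaller true energy preserves the bound only for [alpha >= 0]; a negative
   [alpha] lies below any efficiency, which is nonnegative. *)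
have [alpha0|alpha0] := leP 0 alpha.
  rewrite ler_pdivlMr // (le_trans _ alphaR) // ler_wpM2l //.
  by rewrite lerD2r ler_pM2l.
by apply: (le_trans (ltW alpha0)); rewrite divr_ge0 // ltW.
Qed.

Lemma betaEE_quasi_concave :
  @quasi_concave_on R R^o [set betaSE | 0 <= betaSE] (betaEE_of_SE net).
Proof.
have W0 : 0 <= bandwidth net by exact: ltW.
move=> alpha x y t /set_mem[/= x0 xa] /set_mem[/= y0 ya]; apply/mem_set.
move: xa ya; rewrite /betaEE_of_SE => /le_betaEE; rewrite mulr_ge0 // => /(_ isT).
move=> [g1 [U1 [V1 [P1 [lft1 leR1]]]]] /le_betaEE; rewrite mulr_ge0 // => /(_ isT).
move=> [g2 [U2 [V2 [P2 [lft2 leR2]]]]].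
pose s : R := t%:num; pose s' : R := 1 - s.
have s0 : 0 <= s by rewrite /s ge0.
have s'0 : 0 <= s' by rewrite subr_ge0 /s le1.
have ss' : s + s' = 1 by rewrite addrC subrK.
have z0 : 0 <= s * x + s' * y by rewrite addr_ge0 // mulr_ge0.
suff: alpha <= betaEE net (bandwidth net * (s * x + s' * y)) by split.
apply/le_betaEE; first exact: mulr_ge0.
(* The witnesses are the convex combinations from [lift_conv]; multiplication by the bandwidth
   commutes with them. *)
do 4!eexists; split.
  have := lift_conv s0 s'0 ss' lft1 lft2.
  by rewrite ![_ * (bandwidth net * _)]mulrCA -mulrDr; apply.
rewrite sum2_conv.
(* For fixed [alpha] the left side is affine in [P]; the constant [Pfix] is split using
   [s + s' = 1]. *)
have -> : alpha * (omega net *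
    (s * (\sum_(i < M) \sum_(j < N) P1 i j) +
     s' * (\sum_(i < M) \sum_(j < N) P2 i j)) + Pfix net) =
  s * (alpha * (omega net * (\sum_(i < M) \sum_(j < N) P1 i j) + Pfix net)) +
  s' * (alpha * (omega net * (\sum_(i < M) \sum_(j < N) P2 i j) + Pfix net)).
  by rewrite -{1}[Pfix net]mul1r -ss'; ring.
by rewrite [leRHS]mulrDr !(mulrCA (bandwidth net)) lerD // ler_wpM2l.
Qed.

End Lifting.

Theorem theorem4 (R : realType) (M N : nat) (net : network R M N)
  (M_ge1 : (1 <= M)%N) (N_ge1 : (1 <= N)%N)
  (W_gt0 : 0 < bandwidth net) (omega_gt0 : 0 < omega net)
  (Pfix_gt0 : 0 < Pfix net) (chi_ge0 : 0 <= chi net)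
  (gminU_ge0 : 0 <= gminU net) (gminD_ge0 : 0 <= gminD net)
  (hU_gt0 : forall i, 0 < hU net i) (hD_gt0 : forall j, 0 < hD net j)
  (hI_ge0 : forall i j, 0 <= hI net i j)
  (hI_small : forall i j,
     hI net i j * (1 + chi net) < Num.min (hU net i) (hD net j))
  (gminU_feasible : M%:R * gminU net <= 1)
  (gminD_feasible : N%:R * gminD net <= 1) :
  (forall Rtot : R, 0 <= Rtot ->
     is_maximum (EE_values net Rtot) (betaEE net Rtot)) /\
  @quasi_concave_on R R^o [set betaSE | 0 <= betaSE] (betaEE_of_SE net).
Proof.
split; first by move=> Rtot; exact: betaEE_is_maximum.
exact: betaEE_quasi_concave.
Qed.
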